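(* Let $K\subseteq\mathbb{R}^n$ be nonempty, closed and convex, let $H,Q:\mathbb{R}^n\to\mathbb{R}^n$ be continuous, and let $\eta>0$. Let $R_\eta(x)=H(x)-P_K(H(x)-\eta Q(x))$ and assume that $X^*=\{x\in\mathbb{R}^n:R_\eta(x)=0\}$ is nonempty and closed. Suppose there exists $\beta>0$ such that, for every $x\in\mathbb{R}^n$ and every $\bar x\in P_{X^*}(x)$, $$\langle R_\eta(x),x-\bar x\rangle\ge \beta\|R_\eta(x)\|^2 .$$ Let $\alpha\in(0,2\beta)$, let $x_0\in\mathbb{R}^n$ be arbitrary, and let $x_{k+1}=x_k-\alpha R_\eta(x_k)$ for $k=0,1,2,\dots$. Then, for every $k\ge 0$, $$\operatorname{dist}(x_{k+1},X^* )^2\le \operatorname{dist}(x_k,X^* )^2-\alpha(2\beta-\alpha)\|R_\eta(x_k)\|^2 .$$ Consequently, for every $T\ge 1$, $$\min_{0\le k\le T-1}\operatorname{Gap}_\eta(x_k)^2\le \frac{\operatorname{dist}(x_0,X^* )^2}{\eta^2\alpha(2\beta-\alpha)T}.$$ Thus $\min_{0\le k\le T-1}\operatorname{Gap}_\eta(x_k)=\mathcal{O}(T^{-1/2})$ as $T\to\infty$, and $\|R_\eta(x_k)\|\to 0$ as $k\to\infty$.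
   Context: $\langle\cdot,\cdot\rangle$ and $\|\cdot\|$ are the Euclidean inner product and norm on $\mathbb{R}^n$. $P_K$ is the Euclidean projection onto $K$. For the nonempty closed set $X^*$ (not assumed convex), $\operatorname{dist}(x,X^* )=\min_{y\in X^*}\|x-y\|$, and $P_{X^*}(x)=\{\bar x\in X^*:\|x-\bar x\|=\operatorname{dist}(x,X^* )\}$ is the set of all nearest points of $X^*$ to $x$. The normalized residual measure is $\operatorname{Gap}_\eta(x)=\eta^{-1}\|R_\eta(x)\|$. (The zeros of $R_\eta$ are the solutions of the general variational inequality: find $x^*$ with $H(x^* )\in K$ and $\langle y-H(x^* ),Q(x^* )\rangle\ge 0$ for all $y\in K$.) *)

(* Defs.v *)
From HB Require Import structures.
From mathcomp Require Import all_boot all_order all_algebra.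
From mathcomp Require Import all_classical all_reals all_analysis.

Set Implicit Arguments.
Unset Strict Implicit.
Unset Printing Implicit Defensive.

Import Order.TTheory GRing.Theory Num.Theory.
Import numFieldNormedType.Exports.

Local Open Scope classical_set_scope.
Local Open Scope ring_scope.

(* R^n is 'rV[R]_n.  Its library topology is the usual one, but its library
   norm is the sup norm, hence the separate Euclidean inner product and norm. *)
Definition edot (R : realType) (n : nat) (u v : 'rV[R]_n) : R :=
  \sum_(i < n) u 0 i * v 0 i.

Definition enorm (R : realType) (n : nat) (u : 'rV[R]_n) : R :=
  Num.sqrt (edot u u).

(* For A nonempty and closed this infimum is a minimum. *)
Definition edist_set (R : realType) (n : nat) (A : set 'rV[R]_n)
    (x : 'rV[R]_n) : R :=
  inf [set enorm (x - y) | y in A].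

Definition nearest (R : realType) (n : nat) (A : set 'rV[R]_n)
    (x : 'rV[R]_n) : set 'rV[R]_n :=
  [set y | A y /\ enorm (x - y) = edist_set A x].

(* For K nonempty, closed and convex, [nearest K z] is a singleton, so the
   default value 0 is never used. *)
Definition eproj (R : realType) (n : nat) (K : set 'rV[R]_n)
    (z : 'rV[R]_n) : 'rV[R]_n :=
  xget 0 (nearest K z).

Definition residual (R : realType) (n : nat) (K : set 'rV[R]_n)
    (H Q : 'rV[R]_n -> 'rV[R]_n) (eta : R) (x : 'rV[R]_n) : 'rV[R]_n :=
  H x - eproj K (H x - eta *: Q x).

Definition solution_set (R : realType) (n : nat) (K : set 'rV[R]_n)
    (H Q : 'rV[R]_n -> 'rV[R]_n) (eta : R) : set 'rV[R]_n :=
  [set x | residual K H Q eta x = 0].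

Definition gap (R : realType) (n : nat) (K : set 'rV[R]_n)
    (H Q : 'rV[R]_n -> 'rV[R]_n) (eta : R) (x : 'rV[R]_n) : R :=
  eta^-1 * enorm (residual K H Q eta x).

(* The minimum of u 0, ..., u (T - 1) for T >= 1: the initial value u 0 of the
   iterated minimum is itself one of the terms.  For T = 0 it is u 0. *)
Definition min_first (R : realType) (u : nat -> R) (T : nat) : R :=
  \big[Num.min/u 0%N]_(k < T) u k.

(* Main.v *)
Require Import Defs.
From HB Require Import structures.
From mathcomp Require Import all_boot all_order all_algebra.
From mathcomp Require Import all_classical all_reals all_analysis.
From mathcomp Require Import ring lra.

Set Implicit Arguments.
Unset Strict Implicit.
Unset Printing Implicit Defensive.

Import Order.TTheory GRing.Theory Num.Theory.
Import numFieldNormedType.Exports.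

Local Open Scope classical_set_scope.
Local Open Scope ring_scope.

(** The iteration is a Fejer-type scheme with respect to the solution set
    [X]: although [X] need not be convex, its closedness makes the distance
    from [x k] to [X] attained at some [xbar] (lemma [nearest_exists], a
    compactness argument).  Since [xbar] itself competes in the distance from
    [x k.+1] to [X], expanding
    [enorm (x k.+1 - xbar) ^+ 2 = enorm ((x k - xbar) - alpha *: r) ^+ 2]
    and bounding the cross term with the coercivity inequality gives the
    one-step decrease (lemma [edist_set_descent]).

    The rest concerns real sequences only.  Telescoping the decrease bounds
    the partial sums of [enorm r ^+ 2] by the initial squared distance over
    [alpha * (2 * beta - alpha)] (lemma [sum_le_of_descent]).  The minimum of
    [T] terms is at most their average, which gives the bound in [1 / T]; its
    square root gives the rate of the gap itself.  Bounded partial sums of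
    nonnegative terms form a convergent series, so the terms tend to 0. *)

(** * Euclidean norm and distance to a set *)

Lemma edot_ge0 (R : realType) (n : nat) (u : 'rV[R]_n) : 0 <= edot u u.
Proof. by apply: sumr_ge0 => i _; rewrite -expr2 sqr_ge0. Qed.

Lemma enorm_ge0 (R : realType) (n : nat) (u : 'rV[R]_n) : 0 <= enorm u.
Proof. exact: sqrtr_ge0. Qed.

Lemma sqr_enorm (R : realType) (n : nat) (u : 'rV[R]_n) :
  enorm u ^+ 2 = edot u u.
Proof. by rewrite sqr_sqrtr// edot_ge0. Qed.

Lemma coord_le_enorm (R : realType) (n : nat) (u : 'rV[R]_n) (i : 'I_n) :
  `|u 0 i| <= enorm u.
Proof.
rewrite -sqrtr_sqr; apply: ler_wsqrtr.
rewrite /edot (bigD1 i)//= -expr2 lerDl.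
by apply: sumr_ge0 => j _; rewrite -expr2 sqr_ge0.
Qed.

Lemma sqr_enormBZ (R : realType) (n : nat) (a : R) (u v : 'rV[R]_n) :
  enorm (u - a *: v) ^+ 2 =
    enorm u ^+ 2 - 2 * a * edot v u + a ^+ 2 * enorm v ^+ 2.
Proof.
rewrite !sqr_enorm /edot !mulr_sumr -sumrB -big_split /=.
by apply: eq_bigr => i _; rewrite !mxE; ring.
Qed.

Lemma continuous_enormB (R : realType) (n : nat) (x : 'rV[R]_n) :
  continuous (fun y : 'rV[R]_n => enorm (x - y)).
Proof.
move=> y.
apply: (@continuous_comp _ _ _ (fun z : 'rV[R]_n => edot (x - z) (x - z))
  (@Num.sqrt R)); last exact: sqrt_continuous.
apply: continuous_big => [|i _ {}y]; first exact: add_continuous.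
have cB : {for y, continuous (fun z : 'rV[R]_n => (x - z) 0 i)}.
  have -> : (fun z : 'rV[R]_n => (x - z) 0 i) = (fun z => x 0 i - z 0 i).
    by apply/funext => z; rewrite !mxE.
  by apply: continuousB; [exact: cst_continuous | exact: coord_continuous].
exact: continuousM.
Qed.

Section distance_to_a_set.
Variables (R : realType) (n : nat) (A : set 'rV[R]_n).

Lemma edist_set_le (x y : 'rV[R]_n) : A y -> edist_set A x <= enorm (x - y).
Proof.
move=> Ay; apply: ge_inf; last by exists y.
by exists 0 => _ [z _ <-]; exact: enorm_ge0.
Qed.

Lemma edist_set_ge0 (x : 'rV[R]_n) : 0 <= edist_set A x.
Proof.
rewrite /edist_set; set S := [set enorm (x - y) | y in A].
have [->|/set0P S_nonempty] := eqVneq S set0; first by rewrite inf0.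
by apply: lb_le_inf => // _ [z _ <-]; exact: enorm_ge0.
Qed.

(** A minimizer over the compact set of points of [A] in a box around [x] is
    global when the half-width of the box is the distance from [x] to a known
    point of [A]: a point outside the box is farther from [x] than that one,
    because no coordinate exceeds the Euclidean norm. *)
Lemma nearest_exists (x : 'rV[R]_n) :
  A !=set0 -> closed A -> nearest A x !=set0.
Proof.
move=> [a Aa] Acl; set r := enorm (x - a).
pose box := [set v : 'rV[R]_n |
  forall i, `[x 0 i - r, x 0 i + r]%classic (v ord0 i)].
have boxP v : enorm (x - v) <= r -> box v.
  move=> vr i /=; have := le_trans (coord_le_enorm (x - v) i) vr.
  by rewrite !mxE ler_norml in_itv /= => /andP[? ?]; apply/andP; split; lra.
have box_compact : compact box.
  apply: (@rV_compact _ _ (fun i => `[x 0 i - r, x 0 i + r]%classic)) => i.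
  exact: segment_compact.
have Abox_compact : compact (A `&` box).
  by rewrite setIC; exact: compact_closedI.
have Abox0 : A `&` box !=set0 by exists a; split => //; exact: boxP.
have [c] := compact_EVT_min Abox0 Abox_compact
  (continuous_subspaceT (@continuous_enormB _ _ x)).
rewrite inE => -[Ac _] c_min.
have c_le_r : enorm (x - c) <= r.
  by apply: c_min; rewrite inE; split => //; exact: boxP.
exists c; split => //; apply/eqP; rewrite eq_le edist_set_le// andbT.
apply: lb_le_inf; first by exists r, a.
move=> _ [y Ay <-]; have [y_le|/ltW] := leP (enorm (x - y)) r.
  by apply: c_min; rewrite inE; split => //; exact: boxP.
exact: le_trans.
Qed.

(** The nearest point [xbar] to [x] stays admissible after the step, so the
    new distance is at most the norm of [(x - xbar) - alpha *: r]. *)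
Lemma edist_set_descent (alpha beta : R) (x xbar r : 'rV[R]_n) :
    0 <= alpha -> nearest A x xbar ->
    beta * enorm r ^+ 2 <= edot r (x - xbar) ->
  edist_set A (x - alpha *: r) ^+ 2
    <= edist_set A x ^+ 2 - alpha * (2 * beta - alpha) * enorm r ^+ 2.
Proof.
move=> alpha_ge0 [Axbar <-] coercive.
apply: (@le_trans _ _ (enorm ((x - xbar) - alpha *: r) ^+ 2)).
  by rewrite ler_sqr ?nnegrE ?enorm_ge0 ?edist_set_ge0// addrAC edist_set_le.
rewrite sqr_enormBZ.
have := ler_wpM2l alpha_ge0 coercive; set s := enorm r ^+ 2; nra.
Qed.

End distance_to_a_set.

(** * Real sequences with a summable decrease *)

Section real_sequences.
Variable R : realType.
Implicit Types d g u : nat -> R.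

Lemma sum_le_of_descent (c : R) d g :
    0 < c -> (forall k, 0 <= d k) -> (forall k, d k.+1 <= d k - c * g k) ->
  forall T, \sum_(0 <= k < T) g k <= d 0%N / c.
Proof.
move=> c_gt0 d_ge0 descent T; rewrite ler_pdivlMr// mulr_suml.
apply: (@le_trans _ _ (d 0%N - d T)); last by rewrite gerBl.
rewrite -opprB -telescope_sumr// -sumrN; apply: ler_sum => k _.
have := descent k; lra.
Qed.

Lemma cvg_to_0_of_bounded_sum (M : R) u :
    (forall k, 0 <= u k) -> (forall T, \sum_(0 <= k < T) u k <= M) ->
  u k @[k --> \oo] --> (0 : R).
Proof.
move=> u_ge0 sum_le; apply: (@cvg_series_cvg_0 _ R^o).
apply: nondecreasing_is_cvgn; last by exists M => _ [T _ <-]; exact: sum_le.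
by apply/nondecreasing_seqP => T; rewrite /series /= big_nat_recr//= lerDl.
Qed.

Lemma min_first_le u T (k : nat) : (k < T)%N -> min_first u T <= u k.
Proof. by move=> kT; exact: (@bigmin_le _ _ _ _ (Ordinal kT) (u \o val)). Qed.

Lemma le_min_first (m : R) u T :
  (0 < T)%N -> (forall k, (k < T)%N -> m <= u k) -> m <= min_first u T.
Proof. by move=> T0 le_u; apply: le_bigmin => [|k _]; exact: le_u. Qed.

(** The minimum of [T] terms is at most their average. *)
Lemma min_first_le_of_sum (M : R) u T :
  (0 < T)%N -> \sum_(0 <= k < T) u k <= M -> min_first u T <= M / T%:R.
Proof.
move=> T0 sum_le; rewrite ler_pdivlMr ?ltr0n//; apply: le_trans sum_le.
rewrite mulr_natr -[X in _ *+ X]subn0 -sumr_const_nat big_nat_cond.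
rewrite [leRHS]big_nat_cond; apply: ler_sum => k.
by rewrite andbT => /andP[_ ?]; exact: min_first_le.
Qed.

Lemma min_first_ge0 u T : (forall k, 0 <= u k) -> 0 <= min_first u T.
Proof. by move=> u_ge0; apply: le_bigmin => // k _. Qed.

(** Taking square roots is what turns a rate [1 / T] for the squares into the
    rate [T ^ (- 1 / 2)]. *)
Lemma min_first_bigO (M : R) u :
    (forall k, 0 <= u k) ->
    (forall T, (0 < T)%N -> min_first (fun k => u k ^+ 2) T <= M / T%:R) ->
  (min_first u : nat -> R^o) =O_\oo (fun T : nat => (T%:R `^ (- 2^-1) : R^o)).
Proof.
move=> u_ge0 sqr_rate; apply/eqO_exP.
have M_ge0 : 0 <= M.
  have := sqr_rate 1%N isT; rewrite divr1; apply: le_trans.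
  by apply: min_first_ge0 => k; exact: sqr_ge0.
(* The factor of the rate has to be positive, and [M] may vanish. *)
exists (Num.sqrt M + 1); first by rewrite ltr_wpDl// sqrtr_ge0.
near=> T; have T_gt0 : (0 < T)%N by near: T; exact: nbhs_infty_gt.
have min_ge0 := min_first_ge0 T u_ge0.
rewrite [`|min_first u T|]ger0_norm// [`|_ `^ _|]ger0_norm ?powR_ge0//.
apply: (@le_trans _ _ (Num.sqrt M * T%:R `^ (- 2^-1))); last first.
  by rewrite ler_wpM2r ?powR_ge0// lerDl.
rewrite powRN powR12_sqrt ?ler0n// -sqrtrV ?ler0n// -sqrtrM//.
rewrite -[leLHS](ger0_norm min_ge0) -sqrtr_sqr.
apply: ler_wsqrtr; apply: le_trans (sqr_rate T T_gt0).
apply: le_min_first => // k kT.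
by rewrite ler_sqr ?nnegrE// min_first_le.
Unshelve. all: by end_near. Qed.

End real_sequences.

(** * The projection iteration *)

Theorem theorem4p1 (R : realType) (n : nat) (K : set 'rV[R]_n)
  (K_nonempty : K !=set0) (K_closed : closed K)
  (K_convex : convex_set (K : set (convex_lmodType 'rV[R]_n)))
  (H Q : 'rV[R]_n -> 'rV[R]_n)
  (H_cont : continuous H) (Q_cont : continuous Q)
  (eta : R) (eta_gt0 : 0 < eta)
  (X_nonempty : solution_set K H Q eta !=set0)
  (X_closed : closed (solution_set K H Q eta))
  (beta : R) (beta_gt0 : 0 < beta)
  (coercive : forall x xbar : 'rV[R]_n,
     nearest (solution_set K H Q eta) x xbar ->
     beta * enorm (residual K H Q eta x) ^+ 2
       <= edot (residual K H Q eta x) (x - xbar))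
  (alpha : R) (alpha_gt0 : 0 < alpha) (alpha_lt : alpha < 2 * beta)
  (x : nat -> 'rV[R]_n)
  (x_step : forall k : nat,
     x k.+1 = x k - alpha *: residual K H Q eta (x k)) :
  [/\ forall k : nat,
        edist_set (solution_set K H Q eta) (x k.+1) ^+ 2
          <= edist_set (solution_set K H Q eta) (x k) ^+ 2
             - alpha * (2 * beta - alpha)
               * enorm (residual K H Q eta (x k)) ^+ 2,
      forall T : nat, (1 <= T)%N ->
        min_first (fun k => gap K H Q eta (x k) ^+ 2) T
          <= edist_set (solution_set K H Q eta) (x 0%N) ^+ 2
             / (eta ^+ 2 * alpha * (2 * beta - alpha) * T%:R),
      (min_first (fun k => gap K H Q eta (x k)) : nat -> R^o)
        =O_\oo (fun T : nat => (T%:R `^ (- 2^-1) : R^o))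
    & enorm (residual K H Q eta (x k)) @[k --> \oo] --> (0 : R)].
Proof.
set X := solution_set K H Q eta; set r := residual K H Q eta.
pose c := alpha * (2 * beta - alpha).
have c_gt0 : 0 < c by rewrite mulr_gt0// subr_gt0.
have descent k : edist_set X (x k.+1) ^+ 2
    <= edist_set X (x k) ^+ 2 - c * enorm (r (x k)) ^+ 2.
  have [xbar near_xbar] := nearest_exists (x k) X_nonempty X_closed.
  rewrite x_step.
  exact: edist_set_descent (ltW alpha_gt0) near_xbar (coercive _ _ near_xbar).
have sum_le := sum_le_of_descent c_gt0 (fun k => sqr_ge0 _) descent.
pose M := edist_set X (x 0%N) ^+ 2 / (eta ^+ 2 * c).
have gap_rate T : (0 < T)%N ->
    min_first (fun k => gap K H Q eta (x k) ^+ 2) T <= M / T%:R.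
  move=> T_gt0; apply: min_first_le_of_sum => //.
  under eq_bigr do rewrite exprMn.
  have -> : M = eta^-1 ^+ 2 * (edist_set X (x 0%N) ^+ 2 / c).
    by rewrite exprVn mulrCA -invfM.
  by rewrite -mulr_sumr ler_wpM2l ?sqr_ge0.
split.
- exact: descent.
- by move=> T /gap_rate; rewrite /M /c -mulrA -invfM !mulrA.
- apply: min_first_bigO gap_rate => k.
  by rewrite mulr_ge0 ?enorm_ge0// invr_ge0 ltW.
- have sqr_cvg0 := cvg_to_0_of_bounded_sum (fun k => sqr_ge0 _) sum_le.
  have -> : (fun k => enorm (r (x k)))
      = (fun k => Num.sqrt (enorm (r (x k)) ^+ 2)).
    by apply/funext => k; rewrite sqrtr_sqr ger0_norm ?enorm_ge0.
  rewrite -[X in _ --> X](sqrtr0 R).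
  by apply: continuous_cvg sqr_cvg0; exact: sqrt_continuous.
Qed.
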